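(* Let $k\ge 1$ be an integer and $\lambda>0$ a real number. Let $\{(N(t),I(t)),\,t\ge 0\}$ be the selling/incentive process with parameters $k$ and $\lambda$ described in the context (so $N(t)=1+kI(t)$, $N(0)=1$, and the rate of gaining an incentive when $I(t)=n$ is $\lambda_n=(nk+1)\lambda$). Then for every $t\ge0$, $$E\{N(t)\}=e^{t\lambda k}\qquad\text{and}\qquad \mathrm{Var}\{N(t)\}=e^{t\lambda k}\left(e^{t\lambda k}-1\right)k.$$
   Context: Process: $\{I(t),t\ge 0\}$ is a continuous-time stochastic process with values in $\{0,1,2,\ldots\}$, nondecreasing in $t$, with $I(0)=0$ ($I(t)$ is the number of additional incentives obtained in $(0,t]$). For a fixed integer $k\ge1$, $N(t)=1+kI(t)$ (the minimum number of articles sold in order to have $I(t)+1$ incentives), so $N(t)$ takes values in $\{1,1+k,1+2k,\ldots\}$ and $N(0)=1$. For all $t\ge 0$ and $n\ge 0$ (with $P(I(t)=n)>0$), as $\Delta t\downarrow 0$, $$P\big(I(t+\Delta t)-I(t)=r\mid I(t)=n\big)=\begin{cases}1-\lambda_n\Delta t+o(\Delta t), & r=0,\\ \lambda_n\Delta t+o(\Delta t), & r=1,\\ o(\Delta t), & r\ge 2,\end{cases}$$ where $\lambda_n=(nk+1)\lambda$, $\lambda>0$, and the $o(\Delta t)$ terms do not depend on $t$. *)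

(* Defs.v *)
From HB Require Import structures.
From mathcomp Require Import all_boot all_order all_algebra.
From mathcomp Require Import all_classical all_reals all_analysis.

Set Implicit Arguments.
Unset Strict Implicit.
Unset Printing Implicit Defensive.

Import Order.TTheory GRing.Theory Num.Theory.
Import numFieldNormedType.Exports.

Local Open Scope classical_set_scope.
Local Open Scope ring_scope.

(* Junk value 0 when P B = 0; below it is only used when P B > 0. *)
Definition cond_prob (d : measure_display) (T : measurableType d)
    (R : realType) (P : probability T R) (A B : set T) : R :=
  fine (P (A `&` B)) / fine (P B).

Definition incentive_rate (R : realType) (k : nat) (lambda : R) (n : nat) : R :=
  (n * k + 1)%:R * lambda.

(* Probability, up to o(h), of gaining r incentives in a time h, starting
   from n incentives. *)
Definition gain_prob (R : realType) (k : nat) (lambda : R) (n r : nat)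
    (h : R) : R :=
  match r with
  | 0 => 1 - incentive_rate k lambda n * h
  | 1 => incentive_rate k lambda n * h
  | _ => 0
  end.

(* Processes are indexed by R, but only their values at times t >= 0 matter.
   Since I is nondecreasing, the truncated difference of natural numbers in
   [sip_transition] is the true increment. The error terms being o(h)
   independently of t means that they are dominated by a function e n r of h
   alone that is o(h) as h decreases to 0; they may depend on n and r. *)
Record selling_incentive_process (d : measure_display) (T : measurableType d)
    (R : realType) (P : probability T R) (k : nat) (lambda : R)
    (N I : R -> T -> nat) : Prop := SellingIncentiveProcess {
  sip_measurable : forall t : R, 0 <= t -> measurable_fun [set: T] (I t);
  sip_start : forall w : T, I 0 w = 0%N;
  sip_nondecreasing : forall (s t : R) (w : T),
    0 <= s -> s <= t -> (I s w <= I t w)%N;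
  sip_articles : forall (t : R) (w : T), 0 <= t -> N t w = (1 + k * I t w)%N;
  sip_transition : exists e : nat -> nat -> R -> R,
    (forall n r : nat, e n r =o_ (0^'+) (id : R -> R)) /\
    (forall (n r : nat) (t h : R), 0 <= t -> 0 < h ->
       (0 < P [set w | I t w = n])%E ->
       `| cond_prob P [set w | (I (t + h)%R w - I t w)%N = r]
                      [set w | I t w = n]
          - gain_prob k lambda n r h | <= `| e n r h |)
}.

(* Main.v *)
Require Import Defs.
From HB Require Import structures.
From mathcomp Require Import all_boot all_order all_algebra.
From mathcomp Require Import all_classical all_reals all_analysis.
From mathcomp Require Import measurable_realfun.
From mathcomp Require Import ring lra.

Import Order.TTheory GRing.Theory Num.Theory.
Import numFieldNormedType.Exports.

Local Open Scope classical_set_scope.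
Local Open Scope ring_scope.

(** The number of incentives is a pure birth process with rates
    [(n k + 1) lambda], so its law [p_n(t) = P(I(t) = n)] obeys the Kolmogorov
    forward equations (lemma [incentive_birth_law]).  Writing [N = n k + 1], the
    rising factorials [N (N + k) ... (N + (q - 1) k)] are eigenfunctions of the
    generator, with eigenvalue [q k lambda] (lemma [rising_eigen]), because
    multiplying by the rate [N lambda] turns the forward difference in [n] back
    into the function itself.  Hence the expectation of the [q]-th one grows
    exactly like [exp (q k lambda t)]; [q = 1] gives the mean, [q = 2] gives
    [E (N (N + k)) = (1 + k) exp (2 k lambda t)], and the variance follows.

    Two points need care.  Moments of [I(t)] are not known to be finite
    beforehand, so the argument is run on the process stopped at level [M]
    ([stopped_mean]), where only finitely many forward equations are involved.
    Stopping lowers the drift by a multiple of [phi(M) P(I(t) >= M)].  Dropping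
    this term gives the upper bound [stopped_mean_le], for every [q]; the bound
    for [q + 1] then makes the term of order [1 / M] for [q], and the matching
    lower bound [stopped_mean_lower] follows ([rising_partial_mean_cvg]).

    Moreover the hypothesis only speaks of right increments, with an error
    small uniformly in [t].  No derivative is taken: exponential growth is read
    off from these increments by summing them over a fine subdivision
    ([telescope_le], [gronwall_le], [gronwall_ge]). *)

(** * Increments with an error o(h), uniformly in time *)

Section UniformlySmall.
Set Implicit Arguments.
Unset Strict Implicit.
Variable R : realType.
Implicit Types (D u : R -> R -> R) (e : R -> R).

Definition uniformly_small D :=
  forall eps : R, 0 < eps ->
    \forall h \near 0^'+, forall t : R, 0 <= t -> `|D t h| <= eps * h.

Lemma uniformly_small_dominated D e :
  e =o_ (0^'+) (id : R -> R) ->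
  (forall t h : R, 0 <= t -> 0 < h -> `|D t h| <= `|e h|) ->
  uniformly_small D.
Proof.
move=> /eqoP eo De eps eps0; have {}eo := eo _ eps0; near=> h => t t0.
have h0 : 0 < h by near: h; exact: nbhs_right_gt.
apply: (le_trans (De _ _ t0 h0)).
have : `|e h| <= eps * `|h| by near: h.
by rewrite (gtr0_norm h0).
Unshelve. all: by end_near. Qed.

Lemma uniformly_smallD D1 D2 :
  uniformly_small D1 -> uniformly_small D2 ->
  uniformly_small (fun t h => D1 t h + D2 t h).
Proof.
move=> s1 s2 eps eps0.
have e2 : 0 < eps / 2 by rewrite divr_gt0.
have := s1 _ e2; have := s2 _ e2 => {}s2 {}s1.
near=> h => t t0.
rewrite (splitr eps) mulrDl (le_trans (ler_normD _ _))// lerD//.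
  by move: t t0; near: h.
by move: t t0; near: h.
Unshelve. all: by end_near. Qed.

Lemma uniformly_smallZ (c : R) D :
  uniformly_small D -> uniformly_small (fun t h => c * D t h).
Proof.
move=> sD eps eps0.
have c0 : 0 < `|c| + 1 by rewrite ltr_wpDl.
have e0 : 0 < eps / (`|c| + 1) by rewrite divr_gt0.
have := sD _ e0 => {}sD.
near=> h => t t0.
have h0 : 0 < h by near: h; exact: nbhs_right_gt.
have Dh : `|D t h| <= eps / (`|c| + 1) * h by move: t t0; near: h.
rewrite normrM (@le_trans _ _ ((`|c| + 1) * `|D t h|))//.
  by rewrite ler_wpM2r// lerDl.
rewrite (le_trans (ler_wpM2l (ltW c0) Dh))//.
by rewrite mulrA mulrCA divff ?mulr1// gt_eqF.
Unshelve. all: by end_near. Qed.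

Lemma uniformly_small_sum (D : nat -> R -> R -> R) M :
  (forall n, (n < M)%N -> uniformly_small (D n)) ->
  uniformly_small (fun t h => \sum_(n < M) D n t h).
Proof.
elim: M => [_|M IH sD] eps eps0.
  near=> h => t t0; rewrite big_ord0 normr0 mulr_ge0// ltW//.
have sM := uniformly_smallD (IH (fun n nM => sD n (ltnW nM))) (sD M (ltnSn M)).
have := sM _ eps0; apply: filterS => h sh t t0.
by rewrite big_ord_recr; exact: sh.
Unshelve. all: by end_near. Qed.

(** A function whose right increments over a small step [h] are at most
    [delta h + o(h)], uniformly, grows at most at rate [delta]: cut [[0, T]]
    into equal steps and add up. This replaces the mean value theorem. *)
Lemma telescope_le (v : R -> R) (delta T : R) : 0 <= T ->
  (forall eps, 0 < eps -> \forall h \near 0^'+, forall s, 0 <= s -> s + h <= T ->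
     v (s + h) <= v s + (delta + eps) * h) ->
  v T <= v 0 + delta * T.
Proof.
rewrite le_eqVlt => /predU1P[<- _|T0 step]; first by rewrite mulr0 addr0.
suff H eps : 0 < eps -> v T <= v 0 + (delta + eps) * T.
  apply/ler_addgt0Pr => eps eps0.
  have := H (eps / T) (divr_gt0 eps0 T0).
  by rewrite mulrDl divfK ?gt_eqF// addrA.
move=> eps0; have [r /= r0 rstep] := step _ eps0.
(* [n.+1] steps, the least number that makes the step [T / n.+1] shorter than
   the radius [r] on which the one-step estimate holds. *)
pose n := Num.truncn (T / r).
have nT : T / n.+1%:R < r.
  rewrite ltr_pdivrMr ?ltr0n// mulrC -ltr_pdivrMr// truncnS_gt//.
set h := T / n.+1%:R in nT.
have h0 : 0 < h by rewrite divr_gt0// ltr0n.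
have hT : h * n.+1%:R = T by rewrite divfK// pnatr_eq0.
have rh := rstep h; move: rh => /(_ _ h0); rewrite /ball/= sub0r normrN gtr0_norm//.
move=> /(_ nT) rh.
have main j : (j <= n.+1)%N -> v (h * j%:R) <= v 0 + (delta + eps) * (h * j%:R).
  elim: j => [_|j IH jn]; first by rewrite !mulr0 addr0.
  have := rh (h * j%:R).
  rewrite mulr_ge0 ?(ltW h0)// => /(_ isT).
  have -> : h * j%:R + h = h * j.+1%:R by rewrite -natr1; ring.
  rewrite -{1}hT ler_wpM2l ?(ltW h0) ?ler_nat// => /(_ isT) vj.
  apply: (le_trans vj); have := IH (ltnW jn); rewrite -natr1; lra.
by have := main _ (leqnn _); rewrite hT.
Qed.

(** Since [expR (- c h) (1 + c h) <= 1], the function [expR (- c s) u s] has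
    right increments that are at most [o(h)]. *)
Lemma gronwall_le (c T : R) (u : R -> R) : 0 <= c -> 0 <= T ->
  (forall eps, 0 < eps -> \forall h \near 0^'+, forall s, 0 <= s ->
     u (s + h) <= (1 + c * h) * u s + eps * h) ->
  (forall s, 0 <= s -> 0 <= u s) ->
  u T <= u 0 * expR (c * T).
Proof.
move=> c0 T0 step u0.
have := @telescope_le (fun s => expR (- (c * s)) * u s) 0 T T0.
rewrite mul0r addr0 mulr0 oppr0 expR0 mul1r => H.
rewrite -ler_pdivrMr ?expR_gt0// -expRN mulrC; apply: H => eps eps0.
have := step _ eps0 => {}step; near=> h => s s0 _.
have h0 : 0 < h by near: h; exact: nbhs_right_gt.
have us : u (s + h) <= (1 + c * h) * u s + eps * h by move: s s0; near: h.
rewrite mulrDr opprD expRD add0r.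
have E1 : expR (- (c * s)) <= 1.
  by rewrite -expR0 ler_expR oppr_le0 mulr_ge0.
have E2 : expR (- (c * h)) <= 1.
  by rewrite -expR0 ler_expR oppr_le0 mulr_ge0// ltW.
have E3 : expR (- (c * h)) * (1 + c * h) <= 1.
  rewrite expRN ler_pdivrMl ?expR_gt0// mulr1; exact: expR_ge1Dx.
have e1 := expR_ge0 (- (c * s)); have e2 := expR_ge0 (- (c * h)).
apply: (le_trans (ler_wpM2l (mulr_ge0 e1 e2) us)).
rewrite mulrDr lerD//.
  rewrite -mulrA ler_wpM2l// mulrA ler_piMl// u0//.
rewrite ler_piMl// ?mulr_ge0 ?(ltW h0) ?(ltW eps0)//.
by rewrite mulr_ile1.
Unshelve. all: by end_near. Qed.

(** Here [expR (- c h) (1 + c h) >= 1 - (c h)^2], and the bound [K] on [u] turns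
    the quadratic loss into an [o(h)]; hence [expR (- c s) u s] decreases at rate
    at most [delta]. *)
Lemma gronwall_ge (c delta K T : R) (u : R -> R) : 0 <= c -> 0 <= delta ->
  0 <= T ->
  (forall eps, 0 < eps -> \forall h \near 0^'+, forall s, 0 <= s -> s + h <= T ->
     (1 + c * h) * u s - (delta + eps) * h <= u (s + h)) ->
  (forall s, 0 <= s -> 0 <= u s <= K) ->
  (u 0 - delta * T) * expR (c * T) <= u T.
Proof.
move=> c0 d0 T0 step uK.
have := @telescope_le (fun s => - (expR (- (c * s)) * u s)) delta T T0.
rewrite mulr0 oppr0 expR0 mul1r => H.
rewrite -ler_pdivlMr ?expR_gt0// -expRN mulrC.
suff : - (expR (- (c * T)) * u T) <= - u 0 + delta * T by lra.
apply: H => eps eps0.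
have K0 : 0 <= K by have /andP[? ?] := uK 0 (lexx _); lra.
have e20 : 0 < eps / 2 by rewrite divr_gt0.
have := step _ e20 => {}step; near=> h => s s0 shT.
have h0 : 0 < h by near: h; exact: nbhs_right_gt.
have us : (1 + c * h) * u s - (delta + eps / 2) * h <= u (s + h).
  by move: s s0 shT; near: h.
(* Half of [eps] pays for the error of the step, half for the quadratic loss. *)
have hK : c * c * h * K <= eps / 2.
  have hlt : h < (eps / 2) / (c * c * K + 1).
    near: h; apply: nbhs_right_lt; rewrite divr_gt0// ltr_wpDl// !mulr_ge0//.
  move: hlt; rewrite ltr_pdivlMr ?ltr_wpDl ?mulr_ge0// => hlt; nra.
have /andP[u0 uK'] := uK _ s0.
rewrite mulrDr opprD expRD.
set a := expR (- (c * s)); set b := expR (- (c * h)).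
have a1 : a <= 1 by rewrite -expR0 ler_expR oppr_le0 mulr_ge0.
have b1 : b <= 1 by rewrite -expR0 ler_expR oppr_le0 mulr_ge0// ltW.
have bge : 1 - c * h <= b by exact: expR_ge1Dx.
have a0 : 0 <= a by exact: expR_ge0.
have b0 : 0 <= b by exact: expR_ge0.
have ch0 : 0 <= c * h by rewrite mulr_ge0// ltW.
have de0 : 0 <= (delta + eps / 2) * h by rewrite mulr_ge0 ?addr_ge0// ltW.
have P1 := ler_wpM2l (mulr_ge0 a0 b0) us.
have P2 : (1 - c * h) * ((1 + c * h) * u s) <= b * ((1 + c * h) * u s).
  by rewrite ler_wpM2r// mulr_ge0// addr_ge0.
have P3 : c * h * (c * h) * u s <= eps / 2 * h.
  apply: (@le_trans _ _ (c * h * (c * h) * K)).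
    by rewrite ler_wpM2l// mulr_ge0.
  have -> : c * h * (c * h) * K = (c * c * h * K) * h by ring.
  by rewrite ler_wpM2r// ltW.
have P4 : a * b * ((delta + eps / 2) * h) <= (delta + eps / 2) * h.
  by rewrite ler_piMl// mulr_ile1.
have P5 : u s - eps / 2 * h <= b * ((1 + c * h) * u s) by lra.
have P6 := ler_wpM2l a0 P5.
have P7 : a * (eps / 2 * h) <= eps / 2 * h.
  by rewrite ler_piMl// mulr_ge0// ltW.
lra.
Unshelve. all: by end_near. Qed.

End UniformlySmall.

(** * Forward equations of a pure birth process *)

Section BirthLaw.
Set Implicit Arguments.
Unset Strict Implicit.
Variable R : realType.
Implicit Types (a phi : nat -> R) (p : nat -> R -> R).

Definition inflow a p (n : nat) (t : R) : R :=
  if n is m.+1 then a m * p m t else 0.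

(** A solution of the Kolmogorov forward equations
    [p_n' = a_(n-1) p_(n-1) - a_n p_n] started at [0]. The derivative is
    understood as a uniform right derivative, and the total mass is only
    bounded by [1], as for a process that might explode. *)
Record birth_law a p : Prop := BirthLaw {
  birth_law_ge0 : forall n t, 0 <= t -> 0 <= p n t;
  birth_law_sum_le1 : forall M t, 0 <= t -> \sum_(n < M) p n t <= 1;
  birth_law_start : forall n, p n 0 = (n == 0%N)%:R;
  birth_law_forward : forall n, uniformly_small (fun t h =>
    p n (t + h) - p n t - h * (inflow a p n t - a n * p n t)) }.

(** The probability of having reached level [M]. *)
Definition tail p M (t : R) : R := 1 - \sum_(n < M) p n t.

(** The mean of [phi (minn n M)] under the law [p _ t], mass that is missing
    from [p] being counted as lying above [M]; see [stopped_meanE]. This form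
    only involves [p n t] for [n < M]. *)
Definition stopped_mean p phi M (t : R) : R :=
  phi M - \sum_(n < M) (phi M - phi n) * p n t.

Lemma stopped_meanE p phi M t :
  stopped_mean p phi M t = \sum_(n < M) phi n * p n t + phi M * tail p M t.
Proof.
rewrite /stopped_mean /tail mulrBr mulr1 mulr_sumr.
under eq_bigr do rewrite mulrBl.
by rewrite sumrB; ring.
Qed.

(** Summation by parts. With [K = phi M] the boundary term vanishes. *)
Lemma abel_flow a p phi (K : R) M t :
  \sum_(n < M) (K - phi n) * (inflow a p n t - a n * p n t) =
  - \sum_(n < M) a n * (phi n.+1 - phi n) * p n t - (K - phi M) * inflow a p M t.
Proof.
elim: M => [|M IH]; first by rewrite !big_ord0 /=; ring.
rewrite !big_ord_recr /= IH; ring.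
Qed.

Lemma stopped_mean_step a p phi M : birth_law a p ->
  uniformly_small (fun t h =>
    stopped_mean p phi M (t + h) - stopped_mean p phi M t -
    h * \sum_(n < M) a n * (phi n.+1 - phi n) * p n t).
Proof.
move=> bl.
have S : uniformly_small (fun t h => \sum_(n < M) (phi n - phi M) *
    (p n (t + h) - p n t - h * (inflow a p n t - a n * p n t))).
  apply: (@uniformly_small_sum R (fun n t h => (phi n - phi M) *
    (p n (t + h) - p n t - h * (inflow a p n t - a n * p n t)))) => n _.
  exact/uniformly_smallZ/(birth_law_forward bl).
move=> eps eps0; have := S _ eps0; apply: filterS => h Sh t t0.
apply: le_trans (Sh _ t0); rewrite le_eqVlt; apply/orP; left; apply/eqP.
congr `| _ |.
have := abel_flow a p phi (phi M) M t; rewrite subrr mul0r subr0.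
move=> /(congr1 (fun x => - h * x)); rewrite mulrNN => <-.
rewrite /stopped_mean mulr_sumr.
rewrite [LHS](_ : _ = \sum_(n < M) (phi M - phi n) * p n t -
  \sum_(n < M) (phi M - phi n) * p n (t + h) -
  \sum_(n < M) - h * ((phi M - phi n) * (inflow a p n t - a n * p n t)));
  last by ring.
by rewrite -!sumrB; apply: eq_bigr => n _; ring.
Qed.

Lemma tail_ge0 a p M t : birth_law a p -> 0 <= t -> 0 <= tail p M t.
Proof. by move=> bl t0; rewrite subr_ge0 (birth_law_sum_le1 bl). Qed.

Lemma stopped_mean0 a p phi M : birth_law a p ->
  stopped_mean p phi M 0 = phi 0%N.
Proof.
move=> bl; rewrite /stopped_mean; case: M => [|M].
  by rewrite big_ord0 subr0.
rewrite big_ord_recl big1 => [|i _]; last first.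
  by rewrite (birth_law_start bl) mulr0.
by rewrite (birth_law_start bl) /=; ring.
Qed.

Section Eigenfunction.
Variables (a phi : nat -> R) (p : nat -> R -> R) (c : R).
Hypotheses (bl : birth_law a p) (c0 : 0 <= c) (phi0 : forall n, 0 <= phi n).
Hypothesis phi_nd : {homo phi : m n / (m <= n)%N >-> m <= n}.
Hypothesis phi_eigen : forall n, a n * (phi n.+1 - phi n) = c * phi n.

(** Below level [M] the stopped process has the drift of the original one, hence
    [c phi]; at level [M] it has none. *)
Lemma stopped_mean_drift M t :
  \sum_(n < M) a n * (phi n.+1 - phi n) * p n t =
  c * (stopped_mean p phi M t - phi M * tail p M t).
Proof.
rewrite stopped_meanE addrK mulr_sumr.
by apply: eq_bigr => n _; rewrite phi_eigen mulrA.
Qed.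

Lemma stopped_mean_ge M t : 0 <= t -> phi M * tail p M t <= stopped_mean p phi M t.
Proof.
move=> t0; rewrite stopped_meanE lerDr sumr_ge0// => n _.
by rewrite mulr_ge0// (birth_law_ge0 bl).
Qed.

Lemma stopped_mean_bound M t : 0 <= t -> 0 <= stopped_mean p phi M t <= phi M.
Proof.
move=> t0; apply/andP; split.
  by apply: le_trans (stopped_mean_ge _ t0); rewrite mulr_ge0// (tail_ge0 _ bl).
rewrite /stopped_mean gerBl sumr_ge0// => n _.
by rewrite mulr_ge0 ?(birth_law_ge0 bl)// subr_ge0 phi_nd// ltnW.
Qed.

Lemma stopped_mean_le M t : 0 <= t ->
  stopped_mean p phi M t <= phi 0%N * expR (c * t).
Proof.
move=> t0; rewrite -(stopped_mean0 phi M bl); apply: gronwall_le => //; last first.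
  by move=> s s0; have /andP[] := stopped_mean_bound M s0.
move=> eps eps0; have := stopped_mean_step phi M bl eps0.
move=> S; near=> h => s s0.
have h0 : 0 < h by near: h; exact: nbhs_right_gt.
have : `|stopped_mean p phi M (s + h) - stopped_mean p phi M s -
    h * \sum_(n < M) a n * (phi n.+1 - phi n) * p n s| <= eps * h.
  by move: s s0; near: h.
rewrite stopped_mean_drift ler_norml => /andP[_].
have := mulr_ge0 (mulr_ge0 c0 (ltW h0)) (mulr_ge0 (phi0 M) (tail_ge0 M bl s0)).
lra.
Unshelve. all: by end_near. Qed.

(** Up to time [t], the drift lost at level [M] is at most [c * delta]. *)
Lemma stopped_mean_lower M t delta : 0 <= t ->
  (forall s, 0 <= s -> s <= t -> phi M * tail p M s <= delta) ->
  (phi 0%N - c * delta * t) * expR (c * t) <= stopped_mean p phi M t.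
Proof.
move=> t0 small; rewrite -(stopped_mean0 phi M bl).
have d0 : 0 <= delta.
  apply: le_trans (small 0 (lexx _) t0).
  by rewrite mulr_ge0// (tail_ge0 _ bl).
apply: (@gronwall_ge _ _ _ (phi M)) => //; first by rewrite mulr_ge0.
  move=> eps eps0; have := stopped_mean_step phi M bl eps0.
  move=> S; near=> h => s s0 sht.
  have h0 : 0 < h by near: h; exact: nbhs_right_gt.
  have : `|stopped_mean p phi M (s + h) - stopped_mean p phi M s -
      h * \sum_(n < M) a n * (phi n.+1 - phi n) * p n s| <= eps * h.
    by move: s s0 {sht}; near: h.
  rewrite stopped_mean_drift ler_norml => /andP[+ _].
  have st : s <= t by lra.
  have := ler_wpM2l (mulr_ge0 c0 (ltW h0)) (small _ s0 st).
  lra.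
by move=> s s0; exact: stopped_mean_bound.
Unshelve. all: by end_near. Qed.

(** The sum of [phi n * p n t] over [n < M] differs from the stopped mean by
    [phi M * tail p M t], which the hypothesis makes small; both one-sided
    bounds on the stopped mean then have the same limit. *)
Lemma partial_mean_cvg t : 0 <= t ->
  (forall delta, 0 < delta -> \forall M \near \oo,
     forall s, 0 <= s -> s <= t -> phi M * tail p M s <= delta) ->
  (fun M => \sum_(n < M) phi n * p n t) @ \oo --> phi 0%N * expR (c * t).
Proof.
move=> t0 small; apply/cvgrPdist_le => e e0.
have C0 : 0 < c * t * expR (c * t) + 1 by rewrite ltr_wpDl// !mulr_ge0// expR_ge0.
pose delta := e / (c * t * expR (c * t) + 1).
have d0 : 0 < delta by rewrite divr_gt0.
have := small _ d0; apply: filterS => M sM.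
have lo := stopped_mean_lower t0 sM.
have up := stopped_mean_le M t0.
have tl := sM _ t0 (lexx _).
have tl0 := mulr_ge0 (phi0 M) (tail_ge0 M bl t0).
have eE : e = delta * (c * t * expR (c * t) + 1) by rewrite divfK// gt_eqF.
rewrite stopped_meanE in lo up.
rewrite ler_norml; apply/andP; split; first lra.
by rewrite eE; lra.
Qed.

End Eigenfunction.
End BirthLaw.

(** * Rising factorials *)

Section RisingFactorial.
Set Implicit Arguments.
Unset Strict Implicit.
Variables (R : realType) (k : nat).

(** With [N = n * k + 1] this is [N (N + k) ... (N + (q - 1) k)]. *)
Definition rising (q n : nat) : R := \prod_(i < q) ((n + i) * k + 1)%:R.

Lemma risingSr q n : rising q.+1 n = rising q n * ((n + q) * k + 1)%:R.
Proof. by rewrite /rising big_ord_recr. Qed.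

Lemma risingSl q n : rising q.+1 n = (n * k + 1)%:R * rising q n.+1.
Proof.
rewrite /rising big_ord_recl addn0; congr (_ * _).
by apply: eq_bigr => i _; rewrite lift0 addSnnS.
Qed.

Lemma rising_ge0 q n : 0 <= rising q n.
Proof. by apply: prodr_ge0 => i _; exact: ler0n. Qed.

Lemma rising_homo q : {homo rising q : m n / (m <= n)%N >-> m <= n}.
Proof.
move=> m n mn; apply: ler_prod => i _.
by rewrite ler0n ler_nat leq_add2r leq_mul2r leq_add2r mn orbT.
Qed.

(** Both [N * rising q n.+1] and [rising q n * (N + q k)] equal
    [rising q.+1 n]; subtracting [N * rising q n] leaves [q k * rising q n]. *)
Lemma rising_eigen (lambda : R) q n :
  incentive_rate k lambda n * (rising q n.+1 - rising q n) =
  (q%:R * k%:R * lambda) * rising q n.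
Proof.
have := risingSl q n; rewrite risingSr /incentive_rate !natrD !natrM !natrD.
move=> E; rewrite mulrBr [_ * lambda * rising q n.+1]mulrAC -E; ring.
Qed.

(** The level-[M] term for [q] is the one for [q.+1] divided by
    [(M + q) k + 1], and the latter is bounded on [[0, t]] by [stopped_mean_le]. *)
Lemma rising_partial_mean_cvg (lambda : R) (p : nat -> R -> R) q t :
  (1 <= k)%N -> 0 < lambda -> birth_law (incentive_rate k lambda) p -> 0 <= t ->
  (fun M => \sum_(n < M) rising q n * p n t) @ \oo -->
    rising q 0 * expR (q%:R * k%:R * lambda * t).
Proof.
move=> k1 lambda0 bl t0.
have c0 r : 0 <= r%:R * k%:R * lambda by rewrite !mulr_ge0// ltW.
apply: (partial_mean_cvg bl (c0 q) (rising_ge0 q) (@rising_homo q)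
  (rising_eigen lambda q)) => // delta d0.
pose C := rising q.+1 0 * expR (q.+1%:R * k%:R * lambda * t).
near=> M => s s0 st.
have tl0 : 0 <= tail p M s := tail_ge0 M bl s0.
have tC : rising q.+1 M * tail p M s <= C.
  apply: (le_trans (stopped_mean_ge bl (rising_ge0 q.+1) M s0)).
  apply: (le_trans (stopped_mean_le bl (c0 q.+1) (rising_ge0 q.+1)
    (@rising_homo q.+1) (rising_eigen lambda q.+1) M s0)).
  by rewrite ler_wpM2l ?rising_ge0// ler_expR ler_wpM2l.
have MC : C / delta <= M%:R by near: M; exact: nbhs_infty_ger.
have Mk : M%:R <= ((M + q) * k + 1)%:R :> R.
  rewrite ler_nat (@leq_trans (M + q))// ?leq_addr//.
  by rewrite (@leq_trans ((M + q) * k))// ?leq_addr// leq_pmulr.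
have M0 : 0 < ((M + q) * k + 1)%:R :> R by rewrite ltr0n addn1.
rewrite -(ler_pM2r M0).
apply: (@le_trans _ _ C).
  by move: tC; rewrite risingSr mulrAC.
by rewrite mulrC -ler_pdivrMr// (le_trans MC).
Unshelve. all: by end_near. Qed.

End RisingFactorial.

(** * The law of the number of incentives *)

Section IncentiveLaw.
Set Implicit Arguments.
Unset Strict Implicit.
Variables (d : measure_display) (T : measurableType d) (R : realType).
Variable (P : probability T R).

Definition nat_pmf (X : T -> nat) (n : nat) : R := fine (P [set w | X w = n]).

Lemma measurable_fiber (X : T -> nat) n : measurable_fun [set: T] X ->
  measurable [set w | X w = n].
Proof.
move=> mX; rewrite (_ : [set w | X w = n] = setT `&` X @^-1` [set n]).
  exact: mX.
by rewrite setTI.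
Qed.

Lemma trivIset_fiber (X : T -> nat) D : trivIset D (fun n => [set w | X w = n]).
Proof. by move=> i j _ _ [w [/= <- <-]]. Qed.

(** Splitting the expectation of [f (X w)] along the fibers of [X]. *)
Lemma expectation_series (X : T -> nat) (f : nat -> R) (l : R) :
  measurable_fun [set: T] X -> (forall n, 0 <= f n) ->
  (fun M => \sum_(n < M) f n * nat_pmf X n) @ \oo --> l ->
  (\int[P]_w (f (X w))%:E = l%:E)%E.
Proof.
move=> mX f0 fl.
have mF n := @measurable_fiber X n mX.
have TE : [set: T] = \bigcup_n [set w | X w = n].
  by apply/seteqP; split => // w _; exists (X w).
rewrite TE ge0_integral_bigcup//; last 3 first.
- rewrite -TE; apply/measurable_EFinP.
  have mf : measurable_fun [set: nat] f by [].
  exact: (measurableT_comp mf mX).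
- by move=> w _; rewrite lee_fin.
- exact: trivIset_fiber.
apply: cvg_lim => //.
have -> : (fun M => \sum_(0 <= i < M)
    \int[P]_(x in [set w | X w = i]) (f (X x))%:E)%E =
    (fun M => (\sum_(n < M) f n * nat_pmf X n)%:E).
  apply/funext => M; rewrite big_mkord -sumEFin; apply: eq_bigr => i _.
  rewrite (eq_integral (cst (f i)%:E)) => [|w]; last by rewrite inE/= => ->.
  by rewrite integral_cst// EFinM /nat_pmf fineK// fin_num_measure.
by apply: cvg_EFin => //; exact: nearW.
Qed.

Lemma nat_pmf_sum_le1 (X : T -> nat) M : measurable_fun [set: T] X ->
  \sum_(n < M) nat_pmf X n <= 1.
Proof.
move=> mX; rewrite -lee_fin -sumEFin.
rewrite (eq_bigr (fun n : 'I_M => P [set w | X w = n])); last first.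
  by move=> i _; rewrite /nat_pmf fineK// fin_num_measure//; exact: measurable_fiber.
rewrite -(@measure_semi_additive_ord_I _ _ _ P (fun n => [set w | X w = n])).
- apply: probability_le1; apply: bigsetU_measurable => i _; exact: measurable_fiber.
- by move=> i _; exact: measurable_fiber.
- exact: trivIset_fiber.
- by apply: bigsetU_measurable => i _; exact: measurable_fiber.
Qed.

Variables (k : nat) (lambda : R) (N I : R -> T -> nat).
Hypothesis hNI : selling_incentive_process P k lambda N I.

Definition joint_gain (j r : nat) (t h : R) : R :=
  fine (P ([set w | (I (t + h)%R w - I t w)%N = r] `&` [set w | I t w = j])).

Lemma measurable_gain r t h : 0 <= t -> 0 <= h ->
  measurable [set w | (I (t + h)%R w - I t w)%N = r].
Proof.
move=> t0 h0.
have mt := sip_measurable hNI t0; have mth := sip_measurable hNI (addr_ge0 t0 h0).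
rewrite (_ : mkset _ = \bigcup_i ([set w | I t w = i] `&`
    [set w | I (t + h) w \in [pred n | (n - i)%N == r]])).
  apply: bigcup_measurable => i _; apply: measurableI; first exact: measurable_fiber.
  rewrite -[X in measurable X]setTI.
  exact: (mth measurableT [set n | n \in [pred n | (n - i)%N == r]]).
apply/seteqP; split => [w /= <-|w [i _ [/= <- /eqP//]]].
by exists (I t w) => //; split => //=; rewrite inE.
Qed.

Lemma nat_pmf_gain n t h : 0 <= t -> 0 < h ->
  nat_pmf (I (t + h)) n = \sum_(j < n.+1) joint_gain j (n - j)%N t h.
Proof.
move=> t0 h0; have h0' := ltW h0.
have mt := sip_measurable hNI t0.
pose F j := [set w | (I (t + h)%R w - I t w)%N = (n - j)%N] `&` [set w | I t w = j].
have mF j : measurable (F j).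
  by apply: measurableI; [exact: measurable_gain|exact: measurable_fiber].
have UE : [set w | I (t + h) w = n] = \big[setU/set0]_(j < n.+1) F j.
  have le w : (I t w <= I (t + h)%R w)%N.
    by apply: (sip_nondecreasing hNI); rewrite // lerDl.
  rewrite -bigcup_mkord; apply/seteqP; split => [w /= wn|w [j /= jn [/= E jE]]].
    by exists (I t w); [rewrite /= -wn ltnS le|split => //=; rewrite wn].
  by rewrite -(subnK (le w)) E jE subnK.
apply: EFin_inj; rewrite /nat_pmf fineK; last first.
  by rewrite fin_num_measure// UE; exact: bigsetU_measurable.
rewrite UE (@measure_semi_additive_ord_I _ _ _ P F)//.
- rewrite -sumEFin; apply: eq_bigr => j _.
  by rewrite /joint_gain fineK// fin_num_measure//; exact: (mF j).
- by move=> i j _ _ [w [/= [_ /= <-] [_ /= <-]]].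
- exact: bigsetU_measurable.
Qed.

(** The hypothesis on conditional probabilities, multiplied by the probability of
    the conditioning event; when the latter is null both terms vanish. *)
Lemma joint_gain_small j r :
  uniformly_small (fun t h =>
    joint_gain j r t h - nat_pmf (I t) j * gain_prob k lambda j r h).
Proof.
have [e [eo et]] := sip_transition hNI.
apply: (uniformly_small_dominated (eo j r)) => t h t0 h0.
have mt := sip_measurable hNI t0.
have mB := measurable_fiber j mt.
have mA := measurable_gain r t0 (ltW h0).
rewrite /joint_gain /nat_pmf.
set A := [set w | _ = r] in mA *; set B := [set w | I t w = j] in mB *.
have [PB|PB] := eqVneq (P B) 0%E.
  have -> : P (A `&` B) = 0%E.
    apply/eqP; rewrite -measure_le0 -PB le_measure ?inE//; exact: measurableI.
  by rewrite PB /= mul0r subrr normr0.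
have PBf : P B \is a fin_num by rewrite fin_num_measure.
have PB0 : (0 < P B)%E by rewrite lt0e PB measure_ge0.
have b0 : 0 < fine (P B) by rewrite fine_gt0// PB0 ltey_eq PBf.
have b1 : fine (P B) <= 1.
  by rewrite -lee_fin fineK//; exact: probability_le1.
have -> : fine (P (A `&` B)) = fine (P B) * cond_prob P A B.
  by rewrite /cond_prob mulrC divfK// gt_eqF.
rewrite -mulrBr normrM gtr0_norm//.
apply: le_trans (et j r t h t0 h0 PB0).
by rewrite ler_piMl.
Qed.

(** Only the terms [j = n] (no gain) and [j = n - 1] (one gain) contribute. *)
Lemma sum_gain_prob (p : nat -> R -> R) n t h :
  \sum_(j < n.+1) p j t * gain_prob k lambda j (n - j) h =
  p n t + h * (inflow (incentive_rate k lambda) p n t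
               - incentive_rate k lambda n * p n t).
Proof.
case: n => [|m].
  by rewrite big_ord_recr big_ord0 subnn /=; ring.
rewrite !big_ord_recr /= big1 => [|j _].
  by rewrite subnn subSnn /=; ring.
rewrite subSn ?(ltnW (ltn_ord j))//.
have : (0 < m - j)%N by rewrite subn_gt0.
by case: (m - j)%N => //= i _; rewrite mulr0.
Qed.

Lemma incentive_birth_law :
  birth_law (incentive_rate k lambda) (fun n t => nat_pmf (I t) n).
Proof.
split.
- by move=> n t t0; rewrite fine_ge0.
- by move=> M t t0; apply: nat_pmf_sum_le1; exact: (sip_measurable hNI).
- move=> n; rewrite /nat_pmf; case: n => [|n].
    rewrite (_ : mkset _ = setT) ?probability_setT//.
    by apply/seteqP; split => // w _ /=; rewrite (sip_start hNI).
  rewrite (_ : mkset _ = set0) ?measure0//.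
  by apply/seteqP; split => // w /=; rewrite (sip_start hNI).
- move=> n.
  have S := @uniformly_small_sum R (fun j t h =>
    joint_gain j (n - j) t h - nat_pmf (I t) j * gain_prob k lambda j (n - j) h) n.+1
    (fun j _ => joint_gain_small j (n - j)).
  move=> eps eps0; have := S _ eps0 => {}S; near=> h => t t0.
  have h0 : 0 < h by near: h; exact: nbhs_right_gt.
  rewrite nat_pmf_gain//.
  rewrite -addrA -opprD -(sum_gain_prob (fun n t => nat_pmf (I t) n)).
  rewrite -sumrB; move: t t0; near: h; exact: S.
Unshelve. all: by end_near. Qed.

End IncentiveLaw.

(** * Mean and variance *)

Section Moments.
Set Implicit Arguments.
Unset Strict Implicit.
Variables (d : measure_display) (T : measurableType d) (R : realType).
Variable (P : probability T R).

Lemma variance_nneg (Y : T -> R) (m s : R) :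
  measurable_fun [set: T] Y -> (forall w, 0 <= Y w) ->
  (\int[P]_w (Y w)%:E = m%:E)%E -> (\int[P]_w (Y w ^+ 2)%:E = s%:E)%E ->
  'V_P[Y]%E = (s - m ^+ 2)%:E.
Proof.
move=> mY Y0 Ym Ys.
have Y1 : Y \in Lfun P 1.
  apply/Lfun1_integrable/integrableP; split; first exact/measurable_EFinP.
  under eq_integral do rewrite /= ger0_norm//.
  by rewrite Ym ltry.
have Y2 : Y * Y \in Lfun P 1.
  apply/Lfun1_integrable/integrableP; split.
    by apply/measurable_EFinP; exact: measurable_funM.
  under eq_integral do rewrite /= ger0_norm ?mulr_ge0// -expr2.
  by rewrite Ys ltry.
rewrite /variance covarianceE// unlock Ym.
under eq_integral do rewrite /= -expr2.
by rewrite Ys EFinB EFin_expe. 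
Qed.

End Moments.

Theorem mainTheorem2 (d : measure_display) (T : measurableType d)
    (R : realType) (P : probability T R) (k : nat) (lambda : R)
    (N I : R -> T -> nat)
    (hk : (1 <= k)%N) (hlambda : 0 < lambda)
    (hNI : selling_incentive_process P k lambda N I)
    (t : R) (ht : 0 <= t) :
  ('E_P[fun w : T => ((N t w)%:R : R)] = (expR (t * lambda * k%:R))%:E)%E /\
  ('V_P[fun w : T => ((N t w)%:R : R)] =
     (expR (t * lambda * k%:R) * (expR (t * lambda * k%:R) - 1) * k%:R)%:E)%E.
Proof.
have mI := sip_measurable hNI ht.
have lim q := @rising_partial_mean_cvg R k lambda _ q t hk hlambda
  (incentive_birth_law hNI) ht.
set x := expR (t * lambda * k%:R).
have NE w : (N t w)%:R = rising R k 1 (I t w).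
  rewrite (sip_articles hNI)// /rising big_ord_recl big_ord0 mulr1 addn0.
  by rewrite mulnC addnC.
have lim1 : (fun M => \sum_(n < M) rising R k 1 n * nat_pmf P (I t) n) @ \oo --> x.
  rewrite [x](_ : _ = rising R k 1 0 * expR (1%:R * k%:R * lambda * t)).
    exact: lim.
  rewrite /rising big_ord_recl big_ord0 mulr1 mul0n mul1r /x; congr expR; ring.
(* [N^2 = N (N + k) - k N], the difference of the rising factorials for [q = 2]
   and, up to the factor [k], [q = 1]. *)
have lim2 : (fun M => \sum_(n < M) rising R k 1 n ^+ 2 * nat_pmf P (I t) n) @ \oo -->
    (k%:R + 1) * x ^+ 2 - k%:R * x.
  have -> : (fun M => \sum_(n < M) rising R k 1 n ^+ 2 * nat_pmf P (I t) n) =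
      (fun M => \sum_(n < M) rising R k 2 n * nat_pmf P (I t) n -
         k%:R * \sum_(n < M) rising R k 1 n * nat_pmf P (I t) n).
    apply/funext => M; rewrite mulr_sumr -sumrB; apply: eq_bigr => n _.
    rewrite !risingSr /rising big_ord0 !addn0 !natrD !natrM !natrD; ring.
  apply: cvgB; last exact: cvgMr.
  rewrite [X in _ --> X](_ : _ = rising R k 2 0 * expR (2%:R * k%:R * lambda * t)).
    exact: lim.
  rewrite !risingSr /rising big_ord0 !natrD !natrM /=; congr (_ * _); first ring.
  by rewrite /x -expRM_natl; congr expR; ring.
have EN : (\int[P]_w ((N t w)%:R)%:E = x%:E)%E.
  under eq_integral do rewrite NE.
  exact: (expectation_series mI (rising_ge0 R k 1) lim1).
have EN2 : (\int[P]_w ((N t w)%:R ^+ 2)%:E = ((k%:R + 1) * x ^+ 2 - k%:R * x)%:E)%E.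
  under eq_integral do rewrite NE.
  apply: (@expectation_series _ _ _ _ _ (fun n => rising R k 1 n ^+ 2) _ mI _ lim2).
  by move=> n; exact: sqr_ge0.
split; first by rewrite unlock.
rewrite (variance_nneg _ _ EN EN2)//; first by congr EFin; ring.
have -> : (fun w => (N t w)%:R) = rising R k 1 \o I t by apply/funext => w; exact: NE.
exact: (measurableT_comp _ mI).
Qed.
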